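(* Let $f:\mathbb{R}^d\to\mathbb{R}$ be differentiable and bounded from below, with at least one stationary point and with $L$-Lipschitz gradient for some $L>0$. Let $\boldsymbol{\Psi}(\mathbf{x})=[\mathcal{N}_1(x_1),\ldots,\mathcal{N}_1(x_d)]^\top$ be an admissible component-wise nonlinearity (as defined in the context), and let the noise sequence $\{\mathbf{z}^{(t)}\}_{t\in\mathbb{N}_0}$ satisfy the noise assumption in the context. Let $\mathbf{x}^{(0)}\in\mathbb{R}^d$ be deterministic and let $$\mathbf{x}^{(t+1)}=\mathbf{x}^{(t)}-\alpha_t\boldsymbol{\Psi}\big(\nabla f(\mathbf{x}^{(t)})+\mathbf{z}^{(t)}\big),\qquad \alpha_t=\frac{a}{(t+2)^\delta},$$ for any $\delta\in(3/4,1)$ and $a>0$. Then, for any integer $t\ge 1$ and any $\beta\in(0,1)$, with probability at least $1-\beta$, $$\sum_{k=0}^{t-1}\widetilde{\alpha}_k\min\left\{\frac{\xi\|\nabla f(\mathbf{x}^{(k)})\|}{\sqrt d},\frac{\|\nabla f(\mathbf{x}^{(k)})\|^2}{d}\right\}\le\frac{R(a,\beta,\delta)}{(t+2)^{1-\delta}-2^{1-\delta}},$$ where $\widetilde{\alpha}_k=\alpha_k/\sum_{j=0}^{t-1}\alpha_j$ and $$R(a,\beta,\delta)=\frac{2(1-\delta)}{\phi'(0)}\left[\frac{f(\mathbf{x}^{(0)})-f^\star+\log(1/\beta)}{a}+\frac{a\left(dLC_1^2/2+2NL^2D_{\mathcal{X}}(\mathbf{x}^{(0)})\right)}{2\delt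a-1}+\frac{2a^3dNC_1^2L^2}{(1-\delta)^2(4\delta-3)}\right].$$
   Context: Norms and inner products are Euclidean; $[d]=\{1,\dots,d\}$. Admissible component-wise nonlinearity: $\boldsymbol{\Psi}(\mathbf{x})=[\mathcal{N}_1(x_1),\ldots,\mathcal{N}_1(x_d)]^\top$, where $\mathcal{N}_1:\mathbb{R}\to\mathbb{R}$ is continuous almost everywhere (Lebesgue) and piecewise differentiable; monotonically non-decreasing and odd; either discontinuous at zero or strictly increasing on $(-c_1,c_1)$ for some $c_1>0$; and uniformly bounded, $|\mathcal{N}_1(x)|\le C_1$ for all $x\in\mathbb{R}$, for some $C_1>0$. Noise assumption: the vectors $\{\mathbf{z}^{(t)}\}_{t\in\mathbb{N}_0}$ in $\mathbb{R}^d$ are independent, identically distributed, integrable and zero mean, with a symmetric probability density $p:\mathbb{R}^d\to[0,\infty)$ ($p(-\mathbf{z})=p(\mathbf{z})$) such that $p(\mathbf{z})>0$ for all $\|\mathbf{z}\|\le B_0$, for some $B_0>0$. Notation. $f^\star=\inf_{\mathbf{x}}f(\mathbf{x})$; $\mathcal{X}=\{\mathbf{x}\in\mathbb{R}^d:\nabla f(\mathbf{x})=0\}$; $D_{\mathcal{X}}(\mathbf{x}^{(0)})=\inf_{\mathbf{x}\in\mathcal{X}}\|\mathbf{x}^{(0)}-\mathbf{x}\|^2$. $\boldsymbol{\Phi}(\mathbf{x})=\mathbb{E}_{\mathbf{z}}[\boldsymbol{\Psi}(\mathbf{x}+\mathbf{z})]=\int\boldsymbol{\Psi}(\mathbf{x}+\mathbf{z})p(\mathbf{z})\,d\mathbf{z}$,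 whose $i$-th component is $\phi_i(x_i)=\mathbb{E}[\mathcal{N}_1(x_i+z_i)]$, $z_i$ being the $i$-th component of $\mathbf{z}\sim p$. It is taken as given from prior work (Polyak–Tsypkin) that each $\phi_i$ is non-decreasing and odd, and differentiable at zero with $\phi_i'(0)>0$; set $\phi'(0)=\min_{i\in[d]}\phi_i'(0)$. $\xi>0$ is a constant, depending only on the nonlinearity and the noise, such that $\langle\boldsymbol{\Phi}(\mathbf{x}),\mathbf{x}\rangle\ge\frac{\phi'(0)}{2}\min\{\xi\|\mathbf{x}\|/\sqrt d,\|\mathbf{x}\|^2/d\}$ for all $\mathbf{x}\in\mathbb{R}^d$ (such a constant exists). $N>0$ is a constant, depending only on the nonlinearity, such that the effective noise $\mathbf{e}^{(t)}=\boldsymbol{\Phi}(\nabla f(\mathbf{x}^{(t)}))-\boldsymbol{\Psi}(\nabla f(\mathbf{x}^{(t)})+\mathbf{z}^{(t)})$ satisfies $\mathbb{E}[\exp(\langle\mathbf{x},\mathbf{e}^{(t)}\rangle)\mid\mathcal{F}_t]\le\exp(N\|\mathbf{x}\|^2)$ for all $\mathcal{F}_t$-measurable (in particular all deterministic) $\mathbf{x}\in\mathbb{R}^d$ and all $t$, where $\mathcal{F}_t=\sigma(\mathbf{z}^{(0)},\ldots,\mathbf{z}^{(t-1)})$, $\mathcal{F}_0$ trivial (such a constant exists). *)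

(* Defs.v *)
From HB Require Import structures.
From mathcomp Require Import all_boot all_order all_algebra.
From mathcomp Require Import all_classical all_reals all_analysis.
From mathcomp Require Import measurable_realfun.

Set Implicit Arguments.
Unset Strict Implicit.
Unset Printing Implicit Defensive.

Import Order.TTheory GRing.Theory Num.Theory.
Import numFieldNormedType.Exports.

Local Open Scope classical_set_scope.
Local Open Scope ring_scope.

(* The sigma-algebra on R^d generated by the coordinates, i.e. the Borel
   sigma-algebra. *)
Definition rV_display : measure_display -> measure_display.
Proof. exact. Qed.

Section rV_measurable.
Context {dT : measure_display} {T : measurableType dT} (n : nat).

Let coord (i : 'I_n) (v : 'rV[T]_n) : T := v ord0 i.

Let rV_set0 : g_sigma_preimage coord set0.
Proof. exact: sigma_algebra0. Qed.

Let rV_setC A : g_sigma_preimage coord A -> g_sigma_preimage coord (~` A).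
Proof. exact: sigma_algebraC. Qed.

Let rV_bigcup (F : (set 'rV[T]_n)^nat) :
  (forall i, g_sigma_preimage coord (F i)) ->
  g_sigma_preimage coord (\bigcup_i F i).
Proof. exact: sigma_algebra_bigcup. Qed.

HB.instance Definition _ := @isMeasurable.Build (rV_display dT)
  'rV[T]_n (g_sigma_preimage coord) rV_set0 rV_setC rV_bigcup.

Lemma measurable_coord (i : 'I_n) :
  measurable_fun [set: 'rV[T]_n] (fun v : 'rV[T]_n => v ord0 i).
Proof.
move=> _ Y mY; rewrite setTI; apply: sub_sigma_algebra => /=.
rewrite -bigcup_seq/=; exists i => /=; first by rewrite mem_index_enum.
by exists Y => //; rewrite setTI.
Qed.

Lemma measurable_fun_coordP d1 (T1 : measurableType d1) (f : T1 -> 'rV[T]_n) :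
  measurable_fun [set: T1] f <->
  forall i, measurable_fun [set: T1] (fun x => f x ord0 i).
Proof.
split=> [mf i|mf].
  exact: (measurableT_comp (measurable_coord i) mf).
have mpre : <<s \big[setU/set0]_(i < n)
    preimage_set_system setT (coord i) measurable >> `<=`
    image_set_system [set: T1] f measurable.
  apply: smallest_sub.
    exact/sigma_algebra_image/sigma_algebra_measurable.
  rewrite -bigcup_seq; apply: bigcup_sub => i _ _ [B mB <-].
  by rewrite /image_set_system /= setTI; exact: mf.
by move=> _ Y /mpre.
Qed.

End rV_measurable.

Section lebesgue_rV.
Context {R : realType}.

Definition rV_cons n (xv : R * 'rV[R]_n) : 'rV[R]_n.+1 :=
  row_mx (const_mx xv.1 : 'rV[R]_1) xv.2.

Lemma measurable_rV_cons n : measurable_fun setT (@rV_cons n).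
Proof.
apply/measurable_fun_coordP => i.
rewrite (_ : (fun x => _) = fun x : R * 'rV[R]_n =>
    match fintype.split (i : 'I_(1 + n)) with inl _ => x.1 | inr j => x.2 ord0 j end).
  case: (fintype.split _) => [_|j]; first exact: measurable_fst.
  exact: (measurableT_comp (measurable_coord j) measurable_snd).
apply/funext => x; rewrite /rV_cons mxE; case: (fintype.split _) => // j.
by rewrite mxE.
Qed.

Definition lebesgue_rV_cons n (mu : {measure set 'rV[R]_n -> \bar R}) :
  {measure set 'rV[R]_n.+1 -> \bar R}.
Proof.
refine [the {measure set 'rV[R]_n.+1 -> \bar R} of
  pushforward (@lebesgue_measure R \x^ mu)%E (@rV_cons n)].
exact: measurable_rV_cons.
Defined.

(* Lebesgue measure on R^n: the n-fold product of the one-dimensional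
   Lebesgue measure (the Dirac mass on the one-point space R^0). *)
Fixpoint lebesgue_rV n : {measure set 'rV[R]_n -> \bar R} :=
  match n with
  | 0 => [the {measure set 'rV[R]_0 -> \bar R} of \d_(0 : 'rV[R]_0)]
  | m.+1 => lebesgue_rV_cons (lebesgue_rV m)
  end.

End lebesgue_rV.
Arguments lebesgue_rV : clear implicits.

(* The norm that the library puts on 'rV[R]_d is the sup norm; it is used below
   only through the topology (differentiability). *)
Definition dot (R : realType) (d : nat) (x y : 'rV[R]_d) : R :=
  \sum_(i < d) x ord0 i * y ord0 i.

Definition enorm (R : realType) (d : nat) (x : 'rV[R]_d) : R :=
  Num.sqrt (dot x x).

Definition grad (R : realType) (d : nat) (f : 'rV[R]_d -> R) (x : 'rV[R]_d) :
  'rV[R]_d := \row_i 'D_(delta_mx ord0 i) f x.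

Definition stationary (R : realType) (d : nat) (f : 'rV[R]_d -> R) :
  set 'rV[R]_d := [set x | grad f x = 0].

Definition lipschitz_grad (R : realType) (d : nat) (f : 'rV[R]_d -> R) (L : R) :=
  forall x y, enorm (grad f x - grad f y) <= L * enorm (x - y).

(* Differentiable off a locally finite set of breakpoints; nothing is asked at
   the breakpoints, where the function may jump. *)
Definition piecewise_differentiable (R : realType) (g : R -> R) : Prop :=
  exists S : set R,
    (forall M : R, finite_set (S `&` [set x | `|x| <= M])) /\
    (forall x, ~ S x -> derivable g x 1).

Record admissible_nonlinearity (R : realType) (N1 : R -> R) (C1 : R) : Prop := {
  adm_ae_continuous :
    {ae (@lebesgue_measure R), forall x, {for x, continuous N1}};
  adm_piecewise : piecewise_differentiable N1;
  adm_nondecreasing : {homo N1 : x y / x <= y};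
  adm_odd : forall x, N1 (- x) = - N1 x;
  adm_at_zero : ~ {for 0, continuous N1} \/
    exists2 c1 : R, 0 < c1 &
      {in `]- c1, c1[ &, {homo N1 : x y / x < y}};
  adm_C1_gt0 : 0 < C1;
  adm_bounded : forall x, `|N1 x| <= C1
}.

Definition Psi (R : realType) (d : nat) (N1 : R -> R) (x : 'rV[R]_d) :
  'rV[R]_d := map_mx N1 x.

Definition mutually_independent (dO dT : measure_display)
    (Omega : measurableType dO) (T : measurableType dT) (R : realType)
    (P : probability Omega R) (z : nat -> {RV P >-> T}) : Prop :=
  forall (s : seq nat) (A : nat -> set T), uniq s ->
    (forall t, measurable (A t)) ->
    P (\bigcap_(t in [set` s]) (z t @^-1` A t)) =
    (\prod_(t <- s) P (z t @^-1` A t))%E.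

Record noise_assumption (dO : measure_display) (Omega : measurableType dO)
    (R : realType) (P : probability Omega R) (d : nat)
    (z : nat -> {RV P >-> 'rV[R]_d}) (p : 'rV[R]_d -> R) : Prop := {
  noise_independent : mutually_independent z;
  noise_identical : forall t (A : set 'rV[R]_d), measurable A ->
    distribution P (z t) A = distribution P (z 0%N) A;
  noise_integrable : forall t i,
    P.-integrable setT (fun w => (z t w ord0 i)%:E);
  noise_mean0 : forall t i, ('E_P[fun w => z t w ord0 i] = 0)%E;
  pdf_measurable : measurable_fun setT p;
  pdf_ge0 : forall v, 0 <= p v;
  pdf_noise : forall t (A : set 'rV[R]_d), measurable A ->
    distribution P (z t) A = (\int[lebesgue_rV R d]_(v in A) (p v)%:E)%E;
  pdf_symmetric : forall v, p (- v) = p v;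
  pdf_gt0 : exists2 B0 : R, 0 < B0 & forall v, enorm v <= B0 -> 0 < p v
}.

Definition phi (R : realType) (d : nat) (N1 : R -> R) (p : 'rV[R]_d -> R)
    (i : 'I_d) (s : R) : R :=
  \int[lebesgue_rV R d]_(v in setT) (N1 (s + v ord0 i) * p v).

Definition Phi (R : realType) (d : nat) (N1 : R -> R) (p : 'rV[R]_d -> R)
    (x : 'rV[R]_d) : 'rV[R]_d := \row_i phi N1 p i (x ord0 i).

(* min over i of phi_i'(0); the minimum is seeded with one of its own terms. *)
Definition dphi0 (R : realType) (d : nat) (hd : (0 < d)%N) (N1 : R -> R)
    (p : 'rV[R]_d -> R) : R :=
  \big[Num.min/derive1 (phi N1 p (Ordinal hd)) 0]_(i < d) derive1 (phi N1 p i) 0.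

Definition stepsize (R : realType) (a delta : R) (t : nat) : R :=
  a / (t + 2)%:R `^ delta.

Fixpoint iterate (R : realType) (d : nat) (Omega : Type) (f : 'rV[R]_d -> R)
    (N1 : R -> R) (alpha : nat -> R) (x0 : 'rV[R]_d)
    (z : nat -> Omega -> 'rV[R]_d) (t : nat) (w : Omega) : 'rV[R]_d :=
  match t with
  | 0 => x0
  | k.+1 => let x := iterate f N1 alpha x0 z k w in
            x - alpha k *: Psi N1 (grad f x + z k w)
  end.

Definition effective_noise (R : realType) (d : nat) (Omega : Type)
    (f : 'rV[R]_d -> R) (N1 : R -> R) (p : 'rV[R]_d -> R) (alpha : nat -> R)
    (x0 : 'rV[R]_d) (z : nat -> Omega -> 'rV[R]_d) (t : nat) (w : Omega) :
    'rV[R]_d :=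
  let g := grad f (iterate f N1 alpha x0 z t w) in
  Phi N1 p g - Psi N1 (g + z t w).

(* F_t = sigma(z_0, ..., z_(t-1)) *)
Definition history (dT : measure_display) (T : measurableType dT)
    (Omega : Type) (z : nat -> Omega -> T) (t : nat) : set (set Omega) :=
  g_sigma_preimage (fun k : 'I_t => z k).

Definition measurable_wrt (dT : measure_display) (T : sigmaRingType dT)
    (Omega : Type) (F : set (set Omega)) (X : Omega -> T) : Prop :=
  forall B, measurable B -> F (X @^-1` B).

(* W is a version of E[Y | F] for a nonnegative Y (whose expectation may be
   infinite) and a sub-sigma-algebra F. *)
Definition is_cond_exp (dO : measure_display) (Omega : measurableType dO)
    (R : realType) (P : probability Omega R) (F : set (set Omega))
    (Y W : Omega -> \bar R) : Prop :=
  [/\ forall w, (0 <= W w)%E,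
      measurable_wrt F W &
      forall A, F A -> (\int[P]_(w in A) W w = \int[P]_(w in A) Y w)%E].

(* E[exp <u, e_t> | F_t] <= exp (K |u|^2) a.s., for every t and every
   F_t-measurable u. *)
Definition cond_subgaussian (dO : measure_display) (Omega : measurableType dO)
    (R : realType) (P : probability Omega R) (d : nat)
    (F : nat -> set (set Omega)) (e : nat -> Omega -> 'rV[R]_d) (K : R) : Prop :=
  forall (t : nat) (u : Omega -> 'rV[R]_d), measurable_wrt (F t) u ->
    exists2 W : Omega -> \bar R,
      is_cond_exp P (F t) (fun w => (expR (dot (u w) (e t w)))%:E) W &
      {ae P, forall w, (W w <= (expR (K * enorm (u w) ^+ 2))%:E)%E}.

(* Main.v *)
(* By the descent lemma, summing over k < t,
     sum a_k <Phi g_k, g_k> <= f x_0 - f* + sum a_k <g_k, e_k>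
                               + (d L C1^2 / 2) sum a_k^2,
   where g_k = grad f x_k and e_k is the effective noise.  The conditional
   sub-Gaussian bound makes exp (sum a_k <g_k, e_k> - N sum a_k^2 |g_k|^2) a
   supermartingale started at 1, so by Markov's inequality its exponent is at
   most log (1 / beta) with probability at least 1 - beta.  Since every step has
   coordinates at most a_k C1, the Lipschitz gradient gives
   |g_k|^2 <= 2 L^2 D_X + 2 L^2 d C1^2 (sum_(j < k) a_j)^2, and the remaining
   sums of powers of k + 2 telescope by the tangent-line bounds on powers. *)
Require Import Defs.
From HB Require Import structures.
From mathcomp Require Import all_boot all_order all_algebra.
From mathcomp Require Import all_classical all_reals all_analysis.
From mathcomp Require Import measurable_realfun.
From mathcomp Require Import ring lra.

Set Implicit Arguments.
Unset Strict Implicit.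
Unset Printing Implicit Defensive.

Import Order.TTheory GRing.Theory Num.Theory.
Import numFieldNormedType.Exports HBNNSimple.

Local Open Scope classical_set_scope.
Local Open Scope ring_scope.

(** * Euclidean geometry, power sums and the descent lemma *)
Lemma dotC (R : realType) (d : nat) (x y : 'rV[R]_d) : dot x y = dot y x.
Proof. by apply: eq_bigr => i _; rewrite mulrC. Qed.

Lemma dotDl (R : realType) (d : nat) (x y z : 'rV[R]_d) :
  dot (x + y) z = dot x z + dot y z.
Proof. by rewrite /dot -big_split; apply: eq_bigr => i _; rewrite mxE mulrDl. Qed.

Lemma dotZl (R : realType) (d : nat) (c : R) (x y : 'rV[R]_d) :
  dot (c *: x) y = c * dot x y.
Proof. by rewrite /dot mulr_sumr; apply: eq_bigr => i _; rewrite mxE mulrA. Qed.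

Lemma dotBl (R : realType) (d : nat) (x y z : 'rV[R]_d) :
  dot (x - y) z = dot x z - dot y z.
Proof. by rewrite dotDl -scaleN1r dotZl mulN1r. Qed.

Lemma dotDr (R : realType) (d : nat) (x y z : 'rV[R]_d) :
  dot z (x + y) = dot z x + dot z y.
Proof. by rewrite !(dotC z) dotDl. Qed.

Lemma dotZr (R : realType) (d : nat) (c : R) (x y : 'rV[R]_d) :
  dot x (c *: y) = c * dot x y.
Proof. by rewrite !(dotC x) dotZl. Qed.

Lemma dotBr (R : realType) (d : nat) (x y z : 'rV[R]_d) :
  dot z (x - y) = dot z x - dot z y.
Proof. by rewrite !(dotC z) dotBl. Qed.

Lemma dot_ge0 (R : realType) (d : nat) (x : 'rV[R]_d) : 0 <= dot x x.
Proof. by apply: sumr_ge0 => i _; rewrite -expr2 sqr_ge0. Qed.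

Lemma enorm_ge0 (R : realType) (d : nat) (x : 'rV[R]_d) : 0 <= enorm x.
Proof. exact: sqrtr_ge0. Qed.

Lemma enorm_sq (R : realType) (d : nat) (x : 'rV[R]_d) : enorm x ^+ 2 = dot x x.
Proof. by rewrite sqr_sqrtr // dot_ge0. Qed.

Lemma enormZ (R : realType) (d : nat) (c : R) (x : 'rV[R]_d) :
  enorm (c *: x) = `|c| * enorm x.
Proof.
by rewrite /enorm dotZl dotZr mulrA -expr2 sqrtrM ?sqr_ge0 // sqrtr_sqr.
Qed.

(** Cauchy-Schwarz, by expanding the squared norm of |y|^2 x - <x, y> y and cancelling the factor
    |y|^2. The case y = 0 is separate because of that cancellation. *)
Lemma dot_le_enorm (R : realType) (d : nat) (x y : 'rV[R]_d) :
  dot x y <= enorm x * enorm y.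
Proof.
have [x0|x0] := eqVneq (enorm y) 0; last first.
  have y0 : 0 < enorm y by rewrite lt_neqAle eq_sym x0 enorm_ge0.
  have := dot_ge0 (enorm y ^+ 2 *: x - dot x y *: y).
  rewrite dotBl !dotBr !dotZl !dotZr (dotC y x) -!enorm_sq => h.
  have {}h : 0 <= enorm y ^+ 2 * ((enorm x * enorm y) ^+ 2 - dot x y ^+ 2).
    by rewrite (le_trans h) // le_eqVlt; apply/orP; left; apply/eqP; ring.
  rewrite pmulr_rge0 ?exprn_gt0 // subr_ge0 in h.
  rewrite (le_trans (ler_norm _)) // -(@ler_pXn2r _ 2) ?nnegrE ?mulr_ge0 ?enorm_ge0 //.
  by rewrite real_normK ?num_real.
have y0 : forall i, y ord0 i = 0.
  move=> i; move/eqP: x0; rewrite sqrtr_eq0 => h.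
  have /eqP : dot y y = 0 by apply/eqP; rewrite eq_le h dot_ge0.
  rewrite psumr_eq0 => [/allP /(_ i)|j _]; last by rewrite -expr2 sqr_ge0.
  by rewrite mem_index_enum mulf_eq0 orbb => /(_ isT) /eqP.
by rewrite x0 mulr0 /dot big1 // => i _; rewrite y0 mulr0.
Qed.

Lemma enormD (R : realType) (d : nat) (x y : 'rV[R]_d) :
  enorm (x + y) <= enorm x + enorm y.
Proof.
rewrite -(@ler_pXn2r _ 2) ?nnegrE ?addr_ge0 ?enorm_ge0 //.
rewrite enorm_sq dotDl !dotDr (dotC y x) -!enorm_sq.
have := dot_le_enorm x y; lra.
Qed.

Lemma coord_le_enorm (R : realType) (d : nat) (x : 'rV[R]_d) (i : 'I_d) :
  `|x ord0 i| <= enorm x.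
Proof.
rewrite -sqrtr_sqr /enorm ler_wsqrtr // /dot (bigD1 i) //= expr2 lerDl.
by apply: sumr_ge0 => j _; rewrite -expr2 sqr_ge0.
Qed.

Lemma enorm_le_const (R : realType) (d : nat) (x : 'rV[R]_d) (c : R) :
  (forall i, `|x ord0 i| <= c) -> enorm x ^+ 2 <= d%:R * c ^+ 2.
Proof.
move=> xc; rewrite enorm_sq; apply: (@le_trans _ _ (\sum_(i < d) c ^+ 2)).
  apply: ler_sum => i _; rewrite -expr2 -real_normK ?num_real //.
  by rewrite ler_pXn2r ?nnegrE // (le_trans _ (xc i)).
by rewrite sumr_const card_ord mulr_natl.
Qed.

Lemma ln_le_subr1 (R : realType) (v : R) : 0 < v -> ln v <= v - 1.
Proof.
move=> v0; have := @le_ln1Dx R (v - 1).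
have -> : 1 + (v - 1) = v by ring.
by apply; rewrite ltrBrDl subrr.
Qed.

(** Dividing by x^q and putting u = y / x leaves 1 + q (u - 1) <= u^q. Indeed u^q = exp (q ln u) >=
    1 + q ln u, and q <= 0 reverses ln u <= u - 1. *)
Lemma powR_tangent_le0 (R : realType) (q x y : R) : 0 < x -> 0 < y -> q <= 0 ->
  x `^ q + q * x `^ (q - 1) * (y - x) <= y `^ q.
Proof.
move=> x0 y0 q0; have u0 : 0 < y / x by exact: divr_gt0.
have -> : y = x * (y / x) by rewrite mulrC divfK ?gt_eqF.
rewrite powRM ?(ltW x0) ?(ltW u0) // powRB ?(gt_eqF x0) ?implybT // powRr1 ?(ltW x0) //.
have -> : x `^ q + q * (x `^ q / x) * (x * (y / x) - x) =
  x `^ q * (1 + q * (y / x - 1)) by field; rewrite gt_eqF.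
rewrite ler_pM2l ?powR_gt0 //; set u := y / x in u0 *.
have -> : u `^ q = expR (q * ln u) by rewrite /powR gt_eqF.
apply: le_trans (expR_ge1Dx _); rewrite lerD2l ler_wnM2l //.
exact: ln_le_subr1.
Qed.

(* Concavity of ln: with m = 1 + q (u - 1), both ln (u / m) and ln (1 / m) lie
   below their tangent at 1, and their (q, 1 - q)-average is q ln u - ln m. *)
Lemma powR_tangent_01 (R : realType) (q x y : R) : 0 < x -> 0 < y -> 0 < q < 1 ->
  y `^ q <= x `^ q + q * x `^ (q - 1) * (y - x).
Proof.
move=> x0 y0 /andP[q0 q1]; have u0 : 0 < y / x by exact: divr_gt0.
have -> : y = x * (y / x) by rewrite mulrC divfK ?gt_eqF.
set u := y / x in u0 *.
rewrite powRM ?(ltW x0) ?(ltW u0) // powRB ?(gt_eqF x0) ?implybT // powRr1 ?(ltW x0) //.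
have -> : x `^ q + q * (x `^ q / x) * (x * u - x) =
  x `^ q * (1 + q * (u - 1)) by field; rewrite gt_eqF.
rewrite ler_pM2l ?powR_gt0 //.
have -> : u `^ q = expR (q * ln u) by rewrite /powR gt_eqF.
set m := 1 + q * (u - 1).
have m0 : 0 < m by rewrite /m; nra.
rewrite -[leRHS]lnK ?posrE // ler_expR.
have h1 := ln_le_subr1 (divr_gt0 u0 m0); rewrite ln_div ?posrE // in h1.
have h2 : - ln m <= m^-1 - 1 by rewrite -lnV ?posrE // ln_le_subr1 // invr_gt0.
have h3 : q * (u / m - 1) + (1 - q) * (m^-1 - 1) = 0.
  have mE : q * u + (1 - q) = m by rewrite /m; ring.
  transitivity ((q * u + (1 - q)) / m - 1); first by ring.
  by rewrite mE divff ?gt_eqF // subrr.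
have := ler_wpM2l (ltW q0) h1.
have q1' : 0 <= 1 - q by rewrite subr_ge0 ltW.
have := ler_wpM2l q1' h2; lra.
Qed.

(** Integral comparison in discrete form: the tangent to r^(1 - s) at n + 2, evaluated at n + 1. For
    0 < s < 1 the power is concave, and the tangents at n + 2 and at n + 1 give the next two
    bounds. *)
Lemma powR_step_gt1 (R : realType) (s : R) (n : nat) : 1 < s ->
  (s - 1) * n.+2%:R `^ (- s) <= n.+1%:R `^ (1 - s) - n.+2%:R `^ (1 - s).
Proof.
move=> s1.
have := @powR_tangent_le0 R (1 - s) n.+2%:R n.+1%:R; rewrite !ltr0n => /(_ isT isT).
have -> : 1 - s - 1 = - s by ring.
rewrite -(natr1 n.+1); have : 1 - s <= 0 by lra.
move=> h /(_ h); lra.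
Qed.

Lemma powR_step_lower (R : realType) (s : R) (n : nat) : 0 < s < 1 ->
  (1 - s) * n.+2%:R `^ (- s) <= n.+2%:R `^ (1 - s) - n.+1%:R `^ (1 - s).
Proof.
move=> s1.
have := @powR_tangent_01 R (1 - s) n.+2%:R n.+1%:R; rewrite !ltr0n => /(_ isT isT).
have -> : 1 - s - 1 = - s by ring.
rewrite -(natr1 n.+1); have : 0 < 1 - s < 1 by lra.
move=> h /(_ h); lra.
Qed.

Lemma powR_step_upper (R : realType) (s : R) (n : nat) : 0 < s < 1 ->
  n.+2%:R `^ (1 - s) - n.+1%:R `^ (1 - s) <= (1 - s) * n.+1%:R `^ (- s).
Proof.
move=> s1.
have := @powR_tangent_01 R (1 - s) n.+1%:R n.+2%:R; rewrite !ltr0n => /(_ isT isT).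
have -> : 1 - s - 1 = - s by ring.
rewrite -[in _ * (n.+2%:R - _)](natr1 n.+1); have : 0 < 1 - s < 1 by lra.
move=> h /(_ h); lra.
Qed.

(** The majorising differences telescope to 1 - (t + 1)^(1 - s), hence a bound uniform in t. *)
Lemma sum_powR_gt1 (R : realType) (s : R) (t : nat) : 1 < s ->
  \sum_(0 <= k < t) (k + 2)%:R `^ (- s) <= 1 / (s - 1).
Proof.
move=> s1; rewrite ler_pdivlMr ?subr_gt0 // mulrC mulr_sumr.
apply: (@le_trans _ _ (\sum_(0 <= k < t) (k.+1%:R `^ (1 - s) - k.+2%:R `^ (1 - s)))).
  by apply: ler_sum_nat => k _; rewrite addn2 powR_step_gt1.
rewrite -lerN2 -sumrN; under eq_bigr do rewrite opprB.
rewrite (telescope_sumr (fun k => k.+1%:R `^ (1 - s))) // powR1.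
by rewrite lerBrDr addNr powR_ge0.
Qed.

Lemma sum_powR_le (R : realType) (s : R) (t : nat) : 0 < s < 1 ->
  \sum_(0 <= k < t) (k + 2)%:R `^ (- s) <= t.+1%:R `^ (1 - s) / (1 - s).
Proof.
move=> s1; have s2 : 0 < 1 - s by lra.
rewrite ler_pdivlMr // mulrC mulr_sumr.
apply: (@le_trans _ _ (\sum_(0 <= k < t) (k.+2%:R `^ (1 - s) - k.+1%:R `^ (1 - s)))).
  by apply: ler_sum_nat => k _; rewrite addn2 powR_step_lower.
by rewrite (telescope_sumr (fun k => k.+1%:R `^ (1 - s))) // powR1 gerBl.
Qed.

Lemma sum_powR_ge (R : realType) (s : R) (t : nat) : 0 < s < 1 ->
  ((t + 2)%:R `^ (1 - s) - 2 `^ (1 - s)) / (1 - s)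
    <= \sum_(0 <= k < t) (k + 2)%:R `^ (- s).
Proof.
move=> s1; have s2 : 0 < 1 - s by lra.
rewrite ler_pdivrMr // [leRHS]mulrC mulr_sumr.
have := telescope_sumr (fun k => (k + 2)%:R `^ (1 - s)) (leq0n t).
rewrite add0n => <-.
by apply: ler_sum_nat => k _; rewrite !addn2 powR_step_upper.
Qed.

(** Linearity of the differential: [grad] is made of partial derivatives, while the descent lemma
    differentiates along an arbitrary direction. *)
Lemma grad_derive (R : realType) (d : nat) (f : 'rV[R]_d -> R) (x v : 'rV[R]_d) :
  differentiable f x -> 'D_v f x = dot (grad f x) v.
Proof.
move=> df; rewrite deriveE // {1}(row_sum_delta v) linear_sum.
by apply: eq_bigr => i _; rewrite linearZ /= mxE deriveE // mulrC.
Qed.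

(** The gap [h] has derivative <grad f (x + s v) - grad f x, v> - L |v|^2 s, which is at most 0 for
    s >= 0 by Cauchy-Schwarz and the Lipschitz bound. Comparing h 1 with h 0 avoids integrating the
    gradient. *)
Lemma descent (R : realType) (d : nat) (f : 'rV[R]_d -> R) (L : R) :
  (forall x, differentiable f x) -> lipschitz_grad f L ->
  forall x v, f (x + v) <= f x + dot (grad f x) v + L / 2 * enorm v ^+ 2.
Proof.
move=> df fL x v.
pose h (s : R) := f (x + s *: v) - s * dot (grad f x) v - L / 2 * enorm v ^+ 2 * s ^+ 2.
have dh (s : R) : is_derive s 1 h
    (dot (grad f (x + s *: v)) v - dot (grad f x) v - L * enorm v ^+ 2 * s).
  have dphi : is_derive s 1 (fun r : R => f (x + r *: v)) (dot (grad f (x + s *: v)) v).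
    rewrite -grad_derive //.
    (* Moving the scalar parameter by r moves the point x + s v by r v, so the two difference
       quotients coincide. *)
    have E : (fun r : R => r^-1 *:
        (((fun r0 => f (x + r0 *: v)) \o shift s) (r *: 1) - f (x + s *: v)))
        = (fun r : R => r^-1 *: ((f \o shift (x + s *: v)) (r *: v) - f (x + s *: v))).
      apply/funext => r /=; congr (_ *: (f _ - _)).
      by rewrite -[r *: 1]/(r * 1) mulr1 scalerDl addrCA.
    apply: DeriveDef; first by rewrite /derivable E; exact: diff_derivable.
    by rewrite /derive E.
  rewrite /h; apply: is_derive_eq.
  by rewrite /GRing.scale /=; field.
have : h 1 <= h 0.
  apply: (@ler0_derive1_le_cc _ h 0 1); rewrite ?in_itv /= ?lexx ?ler01 //.
  - move=> s /[!in_itv] /andP[/= s0 s1].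
    rewrite derive1E (@derive_val _ _ _ _ _ _ _ (dh s)) -dotBl subr_le0.
    apply: (le_trans (dot_le_enorm _ _)).
    apply: (le_trans (ler_wpM2r (enorm_ge0 _) (fL _ _))).
    by rewrite addrC addKr enormZ gtr0_norm // le_eqVlt; apply/orP; left; apply/eqP; ring.
  - by apply: derivable_within_continuous => s _; have [] := dh s.
rewrite /h; rewrite !mul0r scale0r scale1r !addr0; lra.
Qed.

(** * Pulling a measurable factor out of a conditional expectation *)
(** Carries measurability from a sub-sigma-algebra to the ambient one, on which the integrals are
    taken. *)
Lemma measurable_fun_g_sigma (d d' : measure_display) (T : measurableType d)
    (T' : measurableType d') (G : set (set T)) (f : T -> T') :
  <<s G >> `<=` measurable ->
  measurable_fun setT (f : g_sigma_algebraType G -> T') -> measurable_fun setT f.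
Proof.
by move=> sG mf _ Y mY; apply: sG; exact: (mf measurableT _ mY).
Qed.

(** Splitting along the level sets of [h] reduces the integral to integrals of Y over sets, the only
    ones about which a conditional expectation gives information. *)
Lemma integral_simple_mul (d : measure_display) (T : measurableType d)
    (R : realType) (mu : {measure set T -> \bar R}) (h : T -> R)
    (Y : T -> \bar R) :
  finite_set (range h) -> (forall r, measurable (h @^-1` [set r])) ->
  (forall x, 0 <= h x) -> measurable_fun setT Y -> (forall x, 0 <= Y x)%E ->
  (\int[mu]_x ((h x)%:E * Y x) =
   \sum_(r \in range h) r%:E * \int[mu]_(x in h @^-1` [set r]) Y x)%E.
Proof.
move=> fh mh h0 mY Y0.
have mi (r : R) : measurable_fun setT (fun x : T => (\1_(h @^-1` [set r]) x : R)%:E).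
  by apply/measurable_EFinP; exact: measurable_indic.
(* Clipping makes the coefficient nonnegative for every real r, as needed to exchange sum and
   integral; on the range of [h] it changes nothing. *)
pose c (r : R) := Num.max r 0.
have cE r : r \in range h -> c r = r.
  by rewrite inE => -[x _ <-]; apply/max_idPl.
transitivity (\int[mu]_x (\sum_(r \in range h)
    (c r)%:E * ((\1_(h @^-1` [set r]) x)%:E * Y x)))%E.
  apply: eq_integral => x _.
  rewrite (fsbigD1 (h x)) //=; last by exists x.
  rewrite indicE mem_set // mul1e cE ?inE; last by exists x.
  rewrite fsbig1 ?adde0 // => r [_ /= /nesym rh].
  by rewrite indicE memNset // mul0e mule0.
have c0 r : (0 <= (c r)%:E)%E by rewrite lee_fin le_max lexx orbT.
have i0 r x : (0 <= (\1_(h @^-1` [set r]) x : R)%:E)%E by rewrite lee_fin indicE.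
rewrite ge0_integral_fsum //=.
- apply: eq_fsbigr => r rh; rewrite ge0_integralZl //.
  + rewrite cE //; congr (_ * _)%E; rewrite [RHS]integral_mkcond.
    by apply: eq_integral => y _; rewrite epatch_indic muleC.
  + exact: emeasurable_funM.
  + by move=> x _; rewrite mule_ge0.
- by move=> r; apply: measurable_funeM; exact: emeasurable_funM.
- by move=> r x _; rewrite !mule_ge0.
Qed.

(** H is an increasing limit of simple functions whose level sets lie in the sub-sigma-algebra. For
    these the identity holds level by level, and monotone convergence, applied once with Y and once
    with W, passes to the limit. *)
Lemma integral_cond_exp (d : measure_display) (T : measurableType d)
    (R : realType) (P : probability T R) (G : set (set T))
    (H : T -> R) (Y W : T -> \bar R) :
  <<s G >> `<=` measurable -> is_cond_exp P <<s G >> Y W ->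
  measurable_fun setT Y -> (forall x, 0 <= Y x)%E ->
  measurable_fun setT (H : g_sigma_algebraType G -> R) ->
  (forall x, 0 < H x) ->
  (\int[P]_x ((H x)%:E * Y x) = \int[P]_x ((H x)%:E * W x))%E.
Proof.
move=> sG [W0 mW WY] mY Y0 mH H0.
have mWT : measurable_fun setT W.
  by move=> _ B mB; rewrite setTI; apply: sG; exact: mW.
have mHE : measurable_fun setT (EFin \o H : g_sigma_algebraType G -> \bar R).
  exact/measurable_EFinP.
pose hs := nnsfun_approx measurableT mHE.
pose h n (x : T) : R := hs n (x : g_sigma_algebraType G).
have sh n r : <<s G >> (h n @^-1` [set r]).
  exact: (measurable_funPTI (hs n) (measurable_set1 r)).
have mh n : measurable_fun setT (h n).
  exact: (measurable_fun_g_sigma sG).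
have E (Z : T -> \bar R) : measurable_fun setT Z -> (forall x, 0 <= Z x)%E ->
    (\int[P]_x ((H x)%:E * Z x) =
     limn (fun n => \int[P]_x ((h n x)%:E * Z x)))%E.
  move=> mZ Z0; rewrite -monotone_convergence //.
  - apply: eq_integral => x _; apply/esym/cvg_lim => //.
    (* Z x may be infinite; the limit of the products is still well defined because H x is not 0. *)
    apply: cvgeM; last exact: cvg_cst.
      have [?|?] := boolP (Z x \is a fin_num); first exact: mule_def_fin.
      by apply: mule_def_neq0_infty => //; rewrite eqe gt_eqF.
    by apply: (cvg_nnsfun_approx measurableT mHE) => // y _; rewrite lee_fin ltW.
  - by move=> n; apply: emeasurable_funM => //; exact/measurable_EFinP.
  - by move=> n x _; rewrite mule_ge0 // lee_fin.
  - move=> x _ m n mn; rewrite lee_wpmul2r // lee_fin.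
    by move/lefP: (nd_nnsfun_approx measurableT mHE mn) => /(_ x).
rewrite !E //; congr (lim (_ @ \oo)); apply/funext => n.
have fh : finite_set (range (h n)) by exact: (@fimfunP _ _ (hs n)).
have hn0 x : 0 <= h n x by exact: (@fun_ge0 _ _ (hs n)).
rewrite !integral_simple_mul //; try by move=> r; apply: sG; exact: sh.
by apply: eq_fsbigr => r _; rewrite WY.
Qed.

(** * Measurability of the iterates *)
Lemma measurable_fun_floor (R : realType) (d : measure_display)
    (T : measurableType d) (g : T -> R) (m : int) :
  measurable_fun setT g -> measurable [set x | Num.floor (g x) = m].
Proof.
move=> mg.
have -> : [set x | Num.floor (g x) = m] = g @^-1` `[m%:~R, (m + 1)%:~R[.
  by apply/seteqP; split => x /=; rewrite in_itv /= -floor_eq => /eqP.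
by rewrite -[X in measurable X]setTI; exact: mg.
Qed.

(* The function is the pointwise limit of its values at the grid points
   floor (n x) / n, which depend on x only through countably many Borel boxes. *)
Lemma lipschitz_measurable (R : realType) (n : nat) (g : 'rV[R]_n -> R) (K : R) :
  (forall x y, `|g x - g y| <= K * enorm (x - y)) -> measurable_fun setT g.
Proof.
move=> gK.
pose fl (k : nat) (x : 'rV[R]_n) : 'rV[int]_n :=
  \row_i Num.floor (k.+1%:R * x ord0 i).
pose pt (k : nat) (v : 'rV[int]_n) : 'rV[R]_n := \row_i ((v ord0 i)%:~R / k.+1%:R).
apply: (@measurable_fun_cvg _ _ _ _ (fun k x => g (pt k (fl k x)))).
- move=> k _ Y mY; rewrite setTI.
  have -> : (fun x => g (pt k (fl k x))) @^-1` Y =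
      \bigcup_(v in [set v | Y (g (pt k v))])
        \bigcap_(i in [set: 'I_n]) [set x | Num.floor (k.+1%:R * x ord0 i) = v ord0 i].
    apply/seteqP; split => [x /= Yx|x [v /= Yv] xv].
      by exists (fl k x) => // i _; rewrite /= mxE.
    suff -> : fl k x = v by [].
    by apply/rowP => i; rewrite mxE xv.
  rewrite bigcup_mkcond; apply: countable_bigcupT_measurable => // v.
  case: ifP => _; last exact: measurable0.
  apply: (fin_bigcap_measurable (D := setT) (F := fun i : 'I_n =>
    [set x : 'rV[R]_n | Num.floor (k.+1%:R * x ord0 i) = v ord0 i])) => // i _.
  apply: (measurable_fun_floor (g := fun x : 'rV[R]_n => k.+1%:R * x ord0 i)).
  by apply: measurable_funM => //; exact: measurable_coord.
- move=> x _.
  (* Each coordinate of the grid point is within 1 / (k + 1) of that of x, so the Euclidean error is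
     at most sqrt n / (k + 1). The sign of K is not known, hence the absolute value. *)
  have hc : (fun k => `|K| * Num.sqrt n%:R * harmonic k) @ \oo --> (0 : R).
    by rewrite -(mulr0 (`|K| * Num.sqrt n%:R)); apply: cvgMl_tmp; exact: cvg_harmonic.
  apply/cvgrPdist_lt => e e0; move/cvgrPdist_lt : hc => /(_ e e0).
  apply: filterS => k /=; rewrite sub0r normrN; apply: le_lt_trans.
  rewrite [leRHS]ger0_norm ?mulr_ge0 ?sqrtr_ge0 ?invr_ge0 //.
  apply: (le_trans (gK _ _)).
  apply: (le_trans (ler_wpM2r (enorm_ge0 _) (ler_norm _))).
  rewrite -mulrA ler_wpM2l // -(@ler_pXn2r _ 2) ?nnegrE ?enorm_ge0
    ?mulr_ge0 ?sqrtr_ge0 ?invr_ge0 //.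
  rewrite exprMn [in leRHS]sqr_sqrtr //; apply: enorm_le_const => i.
  rewrite !mxE /=; set y := x ord0 i.
  have k0 : 0 < k.+1%:R :> R by rewrite ltr0n.
  have /andP[h1 h2] := floor_itv (k.+1%:R * y).
  have -> : y - (Num.floor (k.+1%:R * y))%:~R / k.+1%:R =
      (k.+1%:R * y - (Num.floor (k.+1%:R * y))%:~R) / k.+1%:R.
    by field; rewrite gt_eqF.
  rewrite normrM normfV (gtr0_norm k0) ler_piMl ?invr_ge0 ?(ltW k0) //.
  rewrite ger0_norm ?subr_ge0 // lerBlDl.
  by move: h2; rewrite intrD => /ltW.
Qed.

(** The sigma-algebra on row vectors is generated by the coordinates, and each coordinate of the
    gradient inherits the Lipschitz bound. *)
Lemma lipschitz_grad_measurable (R : realType) (d : nat) (f : 'rV[R]_d -> R) (L : R) :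
  lipschitz_grad f L -> measurable_fun setT (grad f).
Proof.
move=> fL; apply/measurable_fun_coordP => i.
apply: (@lipschitz_measurable _ _ _ L) => x y; apply: le_trans (fL x y).
have <- : (grad f x - grad f y) ord0 i = grad f x ord0 i - grad f y ord0 i.
  by rewrite [LHS]mxE; congr (_ + _); rewrite [LHS]mxE.
exact: coord_le_enorm.
Qed.

Lemma measurable_dot (R : realType) (n : nat) (d : measure_display)
    (T : measurableType d) (u v : T -> 'rV[R]_n) :
  measurable_fun setT u -> measurable_fun setT v ->
  measurable_fun setT (fun w => dot (u w) (v w)).
Proof.
move=> /measurable_fun_coordP mu /measurable_fun_coordP mv.
by apply: measurable_sum => i; exact: measurable_funM.
Qed.

Lemma measurable_enorm (R : realType) (n : nat) (d : measure_display)
    (T : measurableType d) (u : T -> 'rV[R]_n) :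
  measurable_fun setT u -> measurable_fun setT (fun w => enorm (u w)).
Proof.
move=> mu; apply: (measurableT_comp (f := @Num.sqrt R)); last exact: measurable_dot.
apply: nondecreasing_measurable => // x y; exact: ler_wsqrtr.
Qed.

Lemma measurable_rVD (R : realType) (n : nat) (d : measure_display)
    (T : measurableType d) (u v : T -> 'rV[R]_n) :
  measurable_fun setT u -> measurable_fun setT v ->
  measurable_fun setT (fun w => u w + v w).
Proof.
move=> /measurable_fun_coordP mu /measurable_fun_coordP mv.
apply/measurable_fun_coordP => i; under eq_fun do rewrite mxE.
exact: measurable_funD.
Qed.

Lemma measurable_rVZ (R : realType) (n : nat) (d : measure_display)
    (T : measurableType d) (c : R) (u : T -> 'rV[R]_n) :
  measurable_fun setT u -> measurable_fun setT (fun w => c *: u w).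
Proof.
move=> /measurable_fun_coordP mu.
apply/measurable_fun_coordP => i; under eq_fun do rewrite mxE.
exact: measurable_funM.
Qed.

Lemma measurable_rVB (R : realType) (n : nat) (d : measure_display)
    (T : measurableType d) (u v : T -> 'rV[R]_n) :
  measurable_fun setT u -> measurable_fun setT v ->
  measurable_fun setT (fun w => u w - v w).
Proof.
move=> mu mv; under eq_fun do rewrite -scaleN1r.
by apply: measurable_rVD => //; exact: measurable_rVZ.
Qed.

Lemma measurable_Psi (R : realType) (n : nat) (d : measure_display)
    (T : measurableType d) (N1 : R -> R) (u : T -> 'rV[R]_n) :
  {homo N1 : x y / x <= y} -> measurable_fun setT u ->
  measurable_fun setT (fun w => Psi N1 (u w)).
Proof.
move=> N1mono /measurable_fun_coordP mu.
apply/measurable_fun_coordP => i; under eq_fun do rewrite mxE.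
by apply: (measurableT_comp (f := N1)) => //; exact: nondecreasing_measurable.
Qed.

(** The measurable space is arbitrary and only z_0, ..., z_(t-1) are constrained, so the lemma
    serves both for the ambient sigma-algebra and for the history up to t. *)
Lemma measurable_iterate (R : realType) (n : nat) (d : measure_display)
    (T : measurableType d) (f : 'rV[R]_n -> R) (N1 : R -> R) (alpha : nat -> R)
    (x0 : 'rV[R]_n) (z : nat -> T -> 'rV[R]_n) (t : nat) :
  measurable_fun setT (grad f) -> {homo N1 : x y / x <= y} ->
  (forall k, (k < t)%N -> measurable_fun setT (z k)) ->
  measurable_fun setT (iterate f N1 alpha x0 z t).
Proof.
move=> mf N1mono; elim: t => [|t IH] mz /=; first exact: measurable_cst.
have {}IH : measurable_fun setT (iterate f N1 alpha x0 z t).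
  by apply: IH => k /ltnW; exact: mz.
apply: measurable_rVB => //; apply: measurable_rVZ; apply: measurable_Psi => //.
by apply: measurable_rVD; [exact: (measurableT_comp mf)|exact: mz].
Qed.

(** Monotonicity passes through the integral, the integrands being dominated by C1 p. It is what
    makes [Phi], and so the effective noise, measurable. *)
Lemma phi_nondecreasing (R : realType) (n : nat) (N1 : R -> R) (C1 : R)
    (p : 'rV[R]_n -> R) (i : 'I_n) :
  {homo N1 : x y / x <= y} -> (forall x, `|N1 x| <= C1) ->
  measurable_fun setT p -> (forall v, 0 <= p v) ->
  (\int[lebesgue_rV R n]_v (p v)%:E < +oo)%E ->
  {homo phi N1 p i : x y / x <= y}.
Proof.
move=> N1mono N1C mp p0 pfin.
have intp : (lebesgue_rV R n).-integrable setT (EFin \o p).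
  apply/integrableP; split; first exact/measurable_EFinP.
  by under eq_integral do rewrite /= ger0_norm //.
have C1_ge0 : 0 <= C1 by exact: le_trans (N1C 0).
have int (s : R) : (lebesgue_rV R n).-integrable setT
    (EFin \o (fun v : 'rV[R]_n => N1 (s + v ord0 i) * p v)).
  apply: (@le_integrable _ _ _ _ _ measurableT _ (EFin \o (fun v => C1 * p v))).
  - apply/measurable_EFinP; apply: measurable_funM => //.
    apply: (measurableT_comp (f := N1)); first exact: nondecreasing_measurable.
    by apply: measurable_funD => //; exact: measurable_coord.
  - move=> v _ /=; rewrite lee_fin !normrM (ger0_norm C1_ge0).
    by rewrite ler_wpM2r.
  - by have := integrableZl measurableT C1 intp; apply: eq_integrable.
move=> x y xy; apply: le_Rintegral => // v _.
by rewrite ler_wpM2r // N1mono // lerD2r.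
Qed.

(** * Deterministic bounds along a trajectory *)
Lemma stepsizeE (R : realType) (a delta : R) (k : nat) :
  stepsize a delta k = a * (k + 2)%:R `^ (- delta).
Proof. by rewrite /stepsize powRN. Qed.

Lemma stepsize_gt0 (R : realType) (a delta : R) (k : nat) :
  0 < a -> 0 < stepsize a delta k.
Proof. by move=> a0; rewrite divr_gt0 // powR_gt0 // ltr0n addn2. Qed.

Lemma sum_stepsize_sq (R : realType) (a delta : R) (t : nat) : 1 / 2 < delta ->
  \sum_(0 <= k < t) stepsize a delta k ^+ 2 <= a ^+ 2 / (2 * delta - 1).
Proof.
move=> d2.
have E k : stepsize a delta k ^+ 2 = a ^+ 2 * (k + 2)%:R `^ (- (2 * delta)).
  rewrite stepsizeE exprMn; congr (_ * _).
  by rewrite expr2 -powRD ?pnatr_eq0 ?addn2 ?implybT //; congr (_ `^ _); ring.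
under eq_bigr do rewrite E.
rewrite -mulr_sumr ler_wpM2l ?sqr_ge0 // -[leRHS]mul1r.
by apply: sum_powR_gt1; lra.
Qed.

Lemma sum_stepsize_ge (R : realType) (a delta : R) (t : nat) :
  0 < a -> 0 < delta < 1 ->
  a * ((t + 2)%:R `^ (1 - delta) - 2 `^ (1 - delta)) / (1 - delta)
    <= \sum_(0 <= k < t) stepsize a delta k.
Proof.
move=> a0 d1; under eq_bigr do rewrite stepsizeE.
by rewrite -mulr_sumr -mulrA ler_pM2l // sum_powR_ge.
Qed.

(** The partial sum of step sizes is at most a (k + 2)^(1 - delta) / (1 - delta); multiplying by the
    k-th step gives the power 1 - 2 delta, and squaring doubles it. *)
Lemma stepsize_mul_sum (R : realType) (a delta : R) (k : nat) :
  0 < a -> 0 < delta < 1 ->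
  (stepsize a delta k * \sum_(0 <= j < k) stepsize a delta j) ^+ 2
    <= a ^+ 4 / (1 - delta) ^+ 2 * (k + 2)%:R `^ (- (4 * delta - 2)).
Proof.
move=> a0 d1; have d2 : 0 < 1 - delta by lra.
set x : R := (k + 2)%:R.
have x0 : 0 < x by rewrite /x ltr0n addn2.
have h : \sum_(0 <= j < k) stepsize a delta j <= a * (x `^ (1 - delta) / (1 - delta)).
  under eq_bigr do rewrite stepsizeE.
  rewrite -mulr_sumr ler_pM2l //; apply: le_trans (sum_powR_le _ d1) _.
  rewrite ler_wpM2r ?invr_ge0 ?(ltW d2) // ge0_ler_powR ?nnegrE ?(ltW d2) //.
  by rewrite /x ler_nat addn2.
have -> : a ^+ 4 / (1 - delta) ^+ 2 * x `^ (- (4 * delta - 2)) =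
    (stepsize a delta k * (a * (x `^ (1 - delta) / (1 - delta)))) ^+ 2.
  have -> : - (4 * delta - 2) = (- delta + - delta) + ((1 - delta) + (1 - delta)) by ring.
  rewrite stepsizeE -/x !powRD ?(gt_eqF x0) ?implybT //.
  by field; rewrite gt_eqF.
have s0 : 0 <= \sum_(0 <= j < k) stepsize a delta j.
  by apply: sumr_ge0 => j _; exact/ltW/stepsize_gt0.
have /ltW st0 := stepsize_gt0 delta k a0.
have xp := powR_ge0 x (1 - delta).
rewrite ler_pXn2r ?nnegrE ?mulr_ge0 ?(ltW a0) ?invr_ge0 ?(ltW d2) //.
by rewrite ler_wpM2l.
Qed.

(** The exponent 4 delta - 2 exceeds 1 exactly when delta > 3/4, so the sum stays bounded in t. *)
Lemma sum_stepsize_mul_sum (R : realType) (a delta : R) (t : nat) :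
  0 < a -> 3 / 4 < delta < 1 ->
  \sum_(0 <= k < t) (stepsize a delta k * \sum_(0 <= j < k) stepsize a delta j) ^+ 2
    <= a ^+ 4 / ((1 - delta) ^+ 2 * (4 * delta - 3)).
Proof.
move=> a0 d1; have d2 : 0 < delta < 1 by lra.
apply: (@le_trans _ _ (\sum_(0 <= k < t)
    a ^+ 4 / (1 - delta) ^+ 2 * (k + 2)%:R `^ (- (4 * delta - 2)))).
  by apply: ler_sum_nat => k _; exact: stepsize_mul_sum.
have -> : a ^+ 4 / ((1 - delta) ^+ 2 * (4 * delta - 3)) =
    a ^+ 4 / (1 - delta) ^+ 2 * (1 / (4 * delta - 2 - 1)).
  by field; apply/andP; split; apply/eqP; lra.
rewrite -mulr_sumr ler_wpM2l ?divr_ge0 ?exprn_ge0 ?sqr_ge0 ?(ltW a0) //.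
  by lra.
by apply: sum_powR_gt1; lra.
Qed.

Lemma iterate_coord (R : realType) (d : nat) (Omega : Type) (f : 'rV[R]_d -> R)
    (N1 : R -> R) (C1 : R) (alpha : nat -> R) (x0 : 'rV[R]_d)
    (z : nat -> Omega -> 'rV[R]_d) (k : nat) (w : Omega) (i : 'I_d) :
  (forall j, 0 <= alpha j) -> (forall s, `|N1 s| <= C1) ->
  `|(iterate f N1 alpha x0 z k w - x0) ord0 i| <= C1 * \sum_(0 <= j < k) alpha j.
Proof.
move=> a0 N1C; elim: k => [|k IH] /=.
  by rewrite subrr mxE normr0 big_nil mulr0.
rewrite big_nat_recr //= mulrDr addrAC [_ ord0 i]mxE.
apply: (le_trans (ler_normD _ _)); apply: lerD => //.
by rewrite !mxE normrN normrM (ger0_norm (a0 k)) mulrC ler_wpM2r.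
Qed.

Lemma enormD_sq (R : realType) (d : nat) (x y : 'rV[R]_d) :
  enorm (x + y) ^+ 2 <= 2 * enorm x ^+ 2 + 2 * enorm y ^+ 2.
Proof.
apply: (@le_trans _ _ ((enorm x + enorm y) ^+ 2)).
  by rewrite ler_pXn2r ?nnegrE ?addr_ge0 ?enorm_ge0 // enormD.
by have := sqr_ge0 (enorm x - enorm y); lra.
Qed.

(** At a stationary y the Lipschitz bound reads |grad f x| <= L |x - y|. Then x - y is split as (x0
    - y) + (x - x0), whose second term is controlled by the bounded steps. *)
Lemma grad_iterate_bound (R : realType) (d : nat) (Omega : Type)
    (f : 'rV[R]_d -> R) (L : R) (N1 : R -> R) (C1 : R) (alpha : nat -> R)
    (x0 : 'rV[R]_d) (z : nat -> Omega -> 'rV[R]_d) (k : nat) (w : Omega) :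
  0 < L -> lipschitz_grad f L -> stationary f !=set0 ->
  (forall j, 0 <= alpha j) -> (forall s, `|N1 s| <= C1) ->
  enorm (grad f (iterate f N1 alpha x0 z k w)) ^+ 2 <=
    2 * L ^+ 2 * inf [set enorm (x0 - y) ^+ 2 | y in stationary f] +
    2 * L ^+ 2 * d%:R * C1 ^+ 2 * (\sum_(0 <= j < k) alpha j) ^+ 2.
Proof.
move=> L0 fL [y0 fy0] a0 N1C.
set x := iterate _ _ _ _ _ _ _; set s := \sum_(_ <= _ < _) _.
have LL : 0 < 2 * L ^+ 2 by rewrite mulr_gt0 // exprn_gt0.
(* Solving for the infimum leaves a lower bound to check at each stationary y, so no nearest
   stationary point is required. *)
rewrite -lerBlDr [leRHS]mulrC -ler_pdivrMr //; apply: lb_le_inf.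
  by exists (enorm (x0 - y0) ^+ 2); exists y0.
move=> _ [y fy <-]; rewrite ler_pdivrMr // lerBlDr [_ * (2 * _)]mulrC.
have h1 : enorm (grad f x) <= L * enorm (x - y).
  by have := fL x y; rewrite (_ : grad f y = 0) // subr0.
have h2 := enormD_sq (x0 - y) (x - x0).
rewrite (_ : x0 - y + (x - x0) = x - y) in h2; last first.
  by rewrite addrC addrA subrK.
have h3 : enorm (x - x0) ^+ 2 <= d%:R * (C1 * s) ^+ 2.
  by apply: enorm_le_const => i; exact: iterate_coord.
have h4 : enorm (grad f x) ^+ 2 <= L ^+ 2 * enorm (x - y) ^+ 2.
  by rewrite -exprMn ler_pXn2r ?nnegrE ?mulr_ge0 ?enorm_ge0 ?(ltW L0).
apply: (le_trans h4).
apply: (@le_trans _ _ (L ^+ 2 * (2 * enorm (x0 - y) ^+ 2 + 2 * (d%:R * (C1 * s) ^+ 2)))).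
  rewrite ler_wpM2l ?sqr_ge0 //; apply: (le_trans h2); lra.
by rewrite le_eqVlt; apply/orP; left; apply/eqP; ring.
Qed.

(** A pathwise statement, by induction on t: the descent lemma is applied to each step, and [Psi] is
    rewritten as [Phi] minus the effective noise. Keeping f (x_t) on the left makes the induction go
    through. *)
Lemma descent_sum (R : realType) (d : nat) (Omega : Type)
    (f : 'rV[R]_d -> R) (L : R) (N1 : R -> R) (C1 : R) (p : 'rV[R]_d -> R)
    (alpha : nat -> R) (x0 : 'rV[R]_d) (z : nat -> Omega -> 'rV[R]_d) (t : nat)
    (w : Omega) :
  (forall x, differentiable f x) -> 0 < L -> lipschitz_grad f L ->
  (forall s, `|N1 s| <= C1) ->
  f (iterate f N1 alpha x0 z t w) +
    \sum_(0 <= k < t) alpha k *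
      dot (Phi N1 p (grad f (iterate f N1 alpha x0 z k w)))
          (grad f (iterate f N1 alpha x0 z k w)) <=
  f x0 +
    \sum_(0 <= k < t) alpha k *
      dot (grad f (iterate f N1 alpha x0 z k w))
          (effective_noise f N1 p alpha x0 z k w) +
    d%:R * L * C1 ^+ 2 / 2 * \sum_(0 <= k < t) alpha k ^+ 2.
Proof.
move=> df L0 fL N1C; pose g k := grad f (iterate f N1 alpha x0 z k w).
elim: t => [|t IH]; first by rewrite !big_nil mulr0 !addr0.
rewrite !big_nat_recr //=.
set x := iterate _ _ _ _ _ t w in IH *.
have h := descent df fL x (- (alpha t *: Psi N1 (g t + z t w))).
have hP : enorm (Psi N1 (g t + z t w)) ^+ 2 <= d%:R * C1 ^+ 2.
  by apply: enorm_le_const => i; rewrite mxE.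
have E : - (alpha t *: Psi N1 (g t + z t w)) = (- alpha t) *: Psi N1 (g t + z t w).
  by rewrite scaleNr.
rewrite {}E enormZ normrN exprMn real_normK ?num_real // dotZr scaleNr -/(g t) in h.
have -> : dot (g t) (effective_noise f N1 p alpha x0 z t w) =
    dot (Phi N1 p (g t)) (g t) - dot (g t) (Psi N1 (g t + z t w)).
  by rewrite /effective_noise dotBr (dotC (g t) (Phi _ _ _)).
have := ler_wpM2l (sqr_ge0 (alpha t)) hP => {}hP.
have := ler_wpM2l (ltW L0) hP.
move: h; rewrite -/(g t) -/x; lra.
Qed.

(** * The supermartingale and its tail *)
(* Chernoff process: pulling the F_t-measurable factor out of the conditional
   expectation, E[exp S_(t+1)] = E[exp (S_t - K |u_t|^2) E[exp <u_t, e_t> | F_t]]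
   <= E[exp S_t]. *)
Lemma expectation_exp_le1 (dO : measure_display) (Omega : measurableType dO)
    (R : realType) (P : probability Omega R) (d : nat)
    (G : nat -> set (set Omega)) (u e : nat -> Omega -> 'rV[R]_d) (K : R) :
  (forall t, <<s G t >> `<=` measurable) ->
  (forall t k, (k <= t)%N ->
    measurable_fun setT (u k : g_sigma_algebraType (G t) -> 'rV[R]_d)) ->
  (forall t k, (k < t)%N ->
    measurable_fun setT (e k : g_sigma_algebraType (G t) -> 'rV[R]_d)) ->
  cond_subgaussian P (fun t => <<s G t >>) e K ->
  forall t, (\int[P]_w (expR (\sum_(0 <= k < t)
    (dot (u k w) (e k w) - K * enorm (u k w) ^+ 2)))%:E <= 1)%E.
Proof.
move=> sG mu me sub; elim=> [|t IH].
  under eq_integral do rewrite big_nil expR0.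
  by rewrite integral_cst // mul1e probability_le1.
have mut : measurable_fun setT (u t : Omega -> 'rV[R]_d).
  exact: (measurable_fun_g_sigma (sG t) (mu t t (leqnn t))).
have met : measurable_fun setT (e t : Omega -> 'rV[R]_d).
  exact: (measurable_fun_g_sigma (sG t.+1) (me t.+1 t (ltnSn t))).
have mS : measurable_fun setT ((fun w => \sum_(0 <= k < t)
    (dot (u k w) (e k w) - K * enorm (u k w) ^+ 2))
    : g_sigma_algebraType (G t) -> R).
  under eq_fun do rewrite big_mkord.
  apply: measurable_sum => k; have kt := ltn_ord k.
  apply: measurable_funB.
    by apply: measurable_dot; [apply: mu; exact: ltnW|exact: me].
  apply: measurable_funM => //; apply: measurable_funX; apply: measurable_enorm.
  by apply: mu; exact: ltnW.
have mq : measurable_fun setT ((fun w => K * enorm (u t w) ^+ 2)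
    : g_sigma_algebraType (G t) -> R).
  apply: measurable_funM => //; apply: measurable_funX; apply: measurable_enorm.
  exact: mu.
(* [H] gathers all that is known at time t, including the compensator exp (- K |u_t|^2), which will
   cancel the sub-Gaussian bound on [W]. *)
pose H w := expR (\sum_(0 <= k < t)
    (dot (u k w) (e k w) - K * enorm (u k w) ^+ 2) - K * enorm (u t w) ^+ 2).
have mH : measurable_fun setT (H : g_sigma_algebraType (G t) -> R).
  by apply: (measurableT_comp (f := expR)) => //; exact: measurable_funB.
have utG : measurable_wrt <<s G t >> (u t).
  by move=> B mB; have := mu t t (leqnn t) measurableT _ mB; rewrite setTI.
have [W WE WK] := sub t (u t) utG.
have mHT := measurable_fun_g_sigma (sG t) mH.
have mWT : measurable_fun setT W.
  by move=> _ B mB; rewrite setTI; apply: (sG t); case: WE => _ + _; apply.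
have W0 : forall w, (0 <= W w)%E by case: WE.
have E1 : (\int[P]_w (expR (\sum_(0 <= k < t.+1)
    (dot (u k w) (e k w) - K * enorm (u k w) ^+ 2)))%:E =
    \int[P]_w ((H w)%:E * (expR (dot (u t w) (e t w)))%:E))%E.
  apply: eq_integral => w _; rewrite big_nat_recr //= -EFinM -expRD.
  by congr (expR _)%:E; ring.
have mY : measurable_fun setT (fun w => (expR (dot (u t w) (e t w)))%:E).
  apply/measurable_EFinP; apply: (measurableT_comp (f := expR)) => //.
  exact: measurable_dot.
have H_gt0 w : 0 < H w by exact: expR_gt0.
rewrite E1 (integral_cond_exp (sG t) WE) //.
apply: le_trans IH; apply: ae_ge0_le_integral => //.
- by move=> w _; rewrite mule_ge0 // lee_fin expR_ge0.
- by apply: emeasurable_funM => //; exact/measurable_EFinP.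
- apply/measurable_EFinP; apply: (measurableT_comp (f := expR)) => //.
  exact: (measurable_fun_g_sigma (sG t) mS).
move: WK; apply: filterS => w WK _.
apply: (@le_trans _ _ ((H w)%:E * (expR (K * enorm (u t w) ^+ 2))%:E)%E).
  by rewrite lee_wpmul2l // lee_fin expR_ge0.
by rewrite -EFinM lee_fin -expRD subrK.
Qed.

Lemma measurable_sublevel (d : measure_display) (T : measurableType d)
    (R : realType) (S : T -> R) (c : R) :
  measurable_fun setT S -> measurable [set w | S w <= c].
Proof.
move=> mS; have -> : [set w | S w <= c] = setT `&` S @^-1` [set` `]-oo, c]].
  by rewrite setTI; apply/seteqP; split => w /=; rewrite in_itv.
exact: mS.
Qed.

Lemma exp_markov (dO : measure_display) (Omega : measurableType dO)
    (R : realType) (P : probability Omega R) (S : Omega -> R) (beta : R) :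
  measurable_fun setT S -> (\int[P]_w (expR (S w))%:E <= 1)%E -> 0 < beta ->
  ((1 - beta)%:E <= P [set w | (S w <= ln (1 / beta))%R])%E.
Proof.
move=> mS S1 b0; set A := [set w | _].
have mA : measurable A by exact: measurable_sublevel.
have mE : measurable_fun setT (fun w => (expR (S w))%:E).
  by apply/measurable_EFinP; apply: (measurableT_comp (f := expR)).
(* Markov's inequality: off [A] the exponential is at least 1 / beta. *)
have h : ((1 / beta)%:E * P (~` A) <= 1)%E.
  apply: le_trans S1.
  apply: (@le_trans _ _ (\int[P]_(w in ~` A) (expR (S w))%:E)%E); last first.
    apply: ge0_subset_integral => //; exact: measurableC.
  rewrite -integral_cst; last exact: measurableC.
  apply: ge0_le_integral => //.
  - exact: measurableC.
  - by move=> w _; rewrite lee_fin divr_ge0 // ltW.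
  - exact: measurable_funTS.
  - move=> w /negP; rewrite -ltNge => /ltW Sw.
    by rewrite lee_fin -[leLHS]lnK ?ler_expR // posrE divr_gt0.
have PA := probability_setC P (measurableC mA); rewrite setCK in PA.
have fA : P (~` A) \is a fin_num by apply: fin_num_measure; exact: measurableC.
rewrite PA -(fineK fA) -EFinB lee_fin lerD2l lerN2.
rewrite -(fineK fA) -EFinM lee_fin mulrC mul1r ler_pdivrMr // mul1r in h.
exact: h.
Qed.

(** * Adaptedness to the noise history and the high-probability bound *)

Lemma history_measurable (dT dO : measure_display) (T : measurableType dT)
    (Omega : measurableType dO) (z : nat -> Omega -> T) (t k : nat) :
  (k < t)%N -> measurable_fun setT (z k : g_sigma_algebraType
    (\big[setU/set0]_(i < t) preimage_set_system setT (z i) measurable) -> T).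
Proof.
move=> kt _ Y mY; apply: sub_sigma_algebra; rewrite -bigcup_seq /=.
by exists (Ordinal kt); [rewrite /= mem_index_enum|exists Y].
Qed.

Lemma history_sub (dT dO : measure_display) (T : measurableType dT)
    (Omega : measurableType dO) (z : nat -> Omega -> T) (t : nat) :
  (forall k, measurable_fun setT (z k)) ->
  <<s \big[setU/set0]_(i < t) preimage_set_system setT (z i) measurable >>
    `<=` measurable.
Proof.
move=> mz; apply: smallest_sub; first exact: sigma_algebra_measurable.
rewrite -bigcup_seq; apply: bigcup_sub => i _ _ [B mB <-]; exact: mz.
Qed.

Lemma dphi0_gt0 (R : realType) (d : nat) (hd : (0 < d)%N) (N1 : R -> R)
    (p : 'rV[R]_d -> R) :
  (forall i, 0 < derive1 (phi N1 p i) 0) -> 0 < dphi0 hd N1 p.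
Proof.
move=> h; rewrite /dphi0; elim/big_ind : _ => // x y x0 y0.
by rewrite lt_min x0 y0.
Qed.

(** Here z_t itself enters, so the effective noise at time t is measurable for the history up to t +
    1, one step later than the iterate. *)
Lemma measurable_effective_noise (R : realType) (d : nat) (dT : measure_display)
    (T : measurableType dT) (f : 'rV[R]_d -> R) (N1 : R -> R) (p : 'rV[R]_d -> R)
    (alpha : nat -> R) (x0 : 'rV[R]_d) (z : nat -> T -> 'rV[R]_d) (t : nat) :
  measurable_fun setT (grad f) -> {homo N1 : x y / x <= y} ->
  (forall i, {homo phi N1 p i : x y / x <= y}) ->
  (forall k, (k <= t)%N -> measurable_fun setT (z k)) ->
  measurable_fun setT (effective_noise f N1 p alpha x0 z t).
Proof.
move=> mf N1mono phimono mz.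
have mg : measurable_fun setT (fun w => grad f (iterate f N1 alpha x0 z t w)).
  apply: (measurableT_comp mf); apply: measurable_iterate => // k /ltnW.
  exact: mz.
apply: measurable_rVB; last first.
  by apply: measurable_Psi => //; apply: measurable_rVD => //; exact: mz.
apply/measurable_fun_coordP => i; under eq_fun do rewrite mxE.
apply: (measurableT_comp (f := phi N1 p i)); first exact: nondecreasing_measurable.
exact: (measurableT_comp (measurable_coord i) mg).
Qed.

Theorem theorem1 (R : realType) (d : nat) (hd : (0 < d)%N)
  (f : 'rV[R]_d -> R) (L : R)
  (hf_diff : forall x, differentiable f x)
  (hf_bounded : has_lbound (range f))
  (hf_stationary : stationary f !=set0)
  (hL : 0 < L) (hf_lip : lipschitz_grad f L)
  (N1 : R -> R) (C1 : R) (hN1 : admissible_nonlinearity N1 C1)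
  (dO : measure_display) (Omega : measurableType dO) (P : probability Omega R)
  (z : nat -> {RV P >-> 'rV[R]_d}) (p : 'rV[R]_d -> R)
  (hz : noise_assumption z p)
  (hphi : forall i, derivable (phi N1 p i) 0 1 /\ 0 < derive1 (phi N1 p i) 0)
  (xi : R) (hxi : 0 < xi)
  (hxi_Phi : forall x : 'rV[R]_d,
    dphi0 hd N1 p / 2 *
      Num.min (xi * enorm x / Num.sqrt d%:R) (enorm x ^+ 2 / d%:R)
    <= dot (Phi N1 p x) x)
  (a delta : R) (ha : 0 < a) (hdelta : 3 / 4 < delta < 1)
  (x0 : 'rV[R]_d)
  (N : R) (hN : 0 < N)
  (hN_noise : cond_subgaussian P (history (fun k => z k))
     (effective_noise f N1 p (stepsize a delta) x0 (fun k => z k)) N)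
  (t : nat) (ht : (1 <= t)%N) (beta : R) (hbeta : 0 < beta < 1) :
  let alpha := stepsize a delta in
  let alphat (k : nat) := alpha k / \sum_(0 <= j < t) alpha j in
  let x := iterate f N1 alpha x0 (fun k => z k) in
  let fstar := inf (range f) in
  let DX := inf [set enorm (x0 - y) ^+ 2 | y in stationary f] in
  let Rc := 2 * (1 - delta) / dphi0 hd N1 p *
    ((f x0 - fstar + ln (1 / beta)) / a
     + a * (d%:R * L * C1 ^+ 2 / 2 + 2 * N * L ^+ 2 * DX) / (2 * delta - 1)
     + 2 * a ^+ 3 * d%:R * N * C1 ^+ 2 * L ^+ 2 /
       ((1 - delta) ^+ 2 * (4 * delta - 3))) in
  let good : set Omega :=
    [set w | \sum_(0 <= k < t) alphat k *
               Num.min (xi * enorm (grad f (x k w)) / Num.sqrt d%:R)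
                       (enorm (grad f (x k w)) ^+ 2 / d%:R)
             <= Rc / ((t + 2)%:R `^ (1 - delta) - 2 `^ (1 - delta))] in
  ((1 - beta)%:E <= P good)%E.
Proof.
pose alpha := stepsize a delta.
pose alphat (k : nat) := alpha k / \sum_(0 <= j < t) alpha j.
pose x := iterate f N1 alpha x0 (fun k => z k).
pose fstar := inf (range f).
pose DX := inf [set enorm (x0 - y) ^+ 2 | y in stationary f].
pose Rc := 2 * (1 - delta) / dphi0 hd N1 p *
  ((f x0 - fstar + ln (1 / beta)) / a
   + a * (d%:R * L * C1 ^+ 2 / 2 + 2 * N * L ^+ 2 * DX) / (2 * delta - 1)
   + 2 * a ^+ 3 * d%:R * N * C1 ^+ 2 * L ^+ 2 /
     ((1 - delta) ^+ 2 * (4 * delta - 3))).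
pose good : set Omega :=
  [set w | \sum_(0 <= k < t) alphat k *
             Num.min (xi * enorm (grad f (x k w)) / Num.sqrt d%:R)
                     (enorm (grad f (x k w)) ^+ 2 / d%:R)
           <= Rc / ((t + 2)%:R `^ (1 - delta) - 2 `^ (1 - delta))].
change ((1 - beta)%:E <= P good)%E.
have d34 : 3 / 4 < delta by case/andP: hdelta.
have d1 : delta < 1 by case/andP: hdelta.
have d01 : 0 < delta < 1 by lra.
have [b0 b1] := andP hbeta.
have N1mono := adm_nondecreasing hN1.
have N1C := adm_bounded hN1.
have a_ge0 k : 0 <= alpha k by exact/ltW/stepsize_gt0.
have mz k : measurable_fun setT (z k) by exact: measurable_funP.
have mgrad := lipschitz_grad_measurable hf_lip.
(* The integral of the density is the total mass of the law of z_0. *)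
have pint : (\int[lebesgue_rV R d]_v (p v)%:E < +oo)%E.
  rewrite -(pdf_noise hz 0%N measurableT).
  by apply: le_lt_trans (ltry 1); exact: probability_le1.
have phimono i := phi_nondecreasing i N1mono N1C (pdf_measurable hz) (pdf_ge0 hz) pint.
pose g k w := grad f (x k w).
pose e := effective_noise f N1 p alpha x0 (fun k => z k).
(* The exponent of the supermartingale, with u_k = alpha_k g_k as predictable direction. *)
pose S w := \sum_(0 <= k < t) (dot (alpha k *: g k w) (e k w) -
  N * enorm (alpha k *: g k w) ^+ 2).
have mg k : measurable_fun setT (g k).
  by apply: (measurableT_comp mgrad); apply: measurable_iterate.
have S1 : (\int[P]_w (expR (S w))%:E <= 1)%E.
  apply: (expectation_exp_le1 (G := fun t => \big[setU/set0]_(i < t)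
    preimage_set_system setT (z i) measurable)) => //.
  - by move=> s; exact: (@history_sub _ _ _ _ (fun k => z k)).
  (* For k <= s the direction u_k involves z_j with j < k only; in the next item, k < s lets e_k use
     z_k as well. *)
  - move=> s k ks; apply: measurable_rVZ; apply: (measurableT_comp mgrad).
    apply: measurable_iterate => // j jk.
    by apply: (history_measurable (z := fun k => z k)); exact: leq_trans ks.
  - move=> s k ks; apply: measurable_effective_noise => // j jk.
    by apply: (history_measurable (z := fun k => z k)); exact: leq_ltn_trans ks.
have mS : measurable_fun setT S.
  rewrite /S; under eq_fun do rewrite big_mkord.
  apply: measurable_sum => k.
  have me : measurable_fun setT (e k) by apply: measurable_effective_noise.
  have mag : measurable_fun setT (fun w => alpha k *: g k w) by exact: measurable_rVZ.
  apply: measurable_funB; first exact: measurable_dot.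
  by apply: measurable_funM => //; apply: measurable_funX; exact: measurable_enorm.
(* It remains to include the event S <= ln (1 / beta) in [good]; both must be shown measurable, and
   the rest is deterministic at a fixed w. *)
apply: le_trans (exp_markov mS S1 b0) _; apply: le_measure; rewrite ?inE.
- exact: measurable_sublevel.
- pose F w := \sum_(0 <= k < t) alphat k * Num.min (xi * enorm (g k w) / Num.sqrt d%:R)
    (enorm (g k w) ^+ 2 / d%:R).
  have mF : measurable_fun setT F.
    rewrite /F; under eq_fun do rewrite big_mkord.
    apply: measurable_sum => k; apply: measurable_funM => //.
    have men := measurable_enorm (mg k).
    apply: measurable_minr; apply: measurable_funM => //.
      exact: measurable_funM.
    exact: measurable_funX.
  exact: (measurable_sublevel _ mF).
move=> w /= Sw; rewrite /good /=.
have phi0 : 0 < dphi0 hd N1 p by apply: dphi0_gt0 => i; case: (hphi i).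
set m := fun k =>
  Num.min (xi * enorm (g k w) / Num.sqrt d%:R) (enorm (g k w) ^+ 2 / d%:R).
set A := \sum_(0 <= j < t) alpha j.
rewrite (_ : \sum_(0 <= k < t) _ = (\sum_(0 <= k < t) alpha k * m k) / A); last first.
  by rewrite mulr_suml; apply: eq_bigr => k _; rewrite /alphat mulrAC.
set T := _ - 2 `^ (1 - delta).
(* Strict because t >= 1, so that t + 2 > 2. *)
have T0 : 0 < T.
  rewrite subr_gt0 gt0_ltr_powR ?nnegrE ?subr_gt0 //.
  by rewrite ltr_nat addn2 !ltnS.
have AT : a * T / (1 - delta) <= A by exact: sum_stepsize_ge.
have A0 : 0 < A.
  by apply: lt_le_trans AT; rewrite divr_gt0 ?mulr_gt0 // subr_gt0.
set V := f x0 - fstar + ln (1 / beta).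
set c1 := d%:R * L * C1 ^+ 2 / 2 + 2 * N * L ^+ 2 * DX.
set c2 := 2 * d%:R * N * C1 ^+ 2 * L ^+ 2.
have DX0 : 0 <= DX.
  case: hf_stationary => y0 hy0; apply: lb_le_inf.
    by exists (enorm (x0 - y0) ^+ 2); exists y0.
  by move=> _ [y _ <-]; exact: sqr_ge0.
have fx_ge y : fstar <= f y by apply: ge_inf => //; exists y.
have lnb : 0 <= ln (1 / beta).
  by apply: ln_ge0; rewrite ler_pdivlMr // mul1r ltW.
have C1_ge0 := ltW (adm_C1_gt0 hN1).
have L_ge0 := ltW hL.
have N_ge0 := ltW hN.
have q1 := sum_stepsize_sq a t (_ : 1 / 2 < delta).
have q2 := sum_stepsize_mul_sum t ha hdelta.
have {}q1 : \sum_(0 <= k < t) alpha k ^+ 2 <= a ^+ 2 / (2 * delta - 1) by apply: q1; lra.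
set Q1 := a ^+ 2 / (2 * delta - 1) in q1.
set Q2 := a ^+ 4 / ((1 - delta) ^+ 2 * (4 * delta - 3)) in q2.
have c1_ge0 : 0 <= c1.
  by rewrite /c1 addr_ge0 // !mulr_ge0 ?sqr_ge0 ?invr_ge0.
have c2_ge0 : 0 <= c2.
  by rewrite /c2 !mulr_ge0 ?sqr_ge0.
have Q1_ge0 : 0 <= Q1 by rewrite /Q1 divr_ge0 ?sqr_ge0 //; lra.
have Q2_ge0 : 0 <= Q2.
  by rewrite /Q2 divr_ge0 ?exprn_ge0 ?(ltW ha) // mulr_ge0 ?sqr_ge0 //; lra.
(* [B] is a times the bracket in [Rc], with the two sums of step sizes replaced by their bounds [Q1]
   and [Q2]. *)
pose B := V + c1 * Q1 + c2 * Q2.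
have V0 : 0 <= V by rewrite /V addr_ge0 // subr_ge0.
have B0 : 0 <= B.
  by apply: addr_ge0; [apply: addr_ge0 => //|]; exact: mulr_ge0.
have key : dphi0 hd N1 p / 2 * \sum_(0 <= k < t) alpha k * m k <= B.
  have h1 := descent_sum p alpha x0 (fun k => z k) t w hf_diff hL hf_lip N1C.
  have h2 : dphi0 hd N1 p / 2 * \sum_(0 <= k < t) alpha k * m k <=
      \sum_(0 <= k < t) alpha k * dot (Phi N1 p (g k w)) (g k w).
    rewrite mulr_sumr; apply: ler_sum => k _.
    by rewrite mulrCA; apply: ler_wpM2l => //; exact: hxi_Phi.
  (* The noise term is S plus its own compensator; S is at most ln (1 / beta) at w, and the
     compensator is bounded through the gradient growth in [h4]. *)
  have h3 : \sum_(0 <= k < t) alpha k * dot (g k w) (e k w) =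
      S w + N * \sum_(0 <= k < t) alpha k ^+ 2 * enorm (g k w) ^+ 2.
    rewrite /S mulr_sumr -big_split; apply: eq_bigr => k _ /=.
    by rewrite enormZ exprMn real_normK ?num_real // dotZl subrK.
  have h4 : \sum_(0 <= k < t) alpha k ^+ 2 * enorm (g k w) ^+ 2 <=
      2 * L ^+ 2 * DX * \sum_(0 <= k < t) alpha k ^+ 2 +
      2 * L ^+ 2 * d%:R * C1 ^+ 2 *
        \sum_(0 <= k < t) (alpha k * \sum_(0 <= j < k) alpha j) ^+ 2.
    rewrite !mulr_sumr -big_split; apply: ler_sum => k _ /=.
    have := grad_iterate_bound x0 (fun k => z k) k w hL hf_lip hf_stationary a_ge0 N1C.
    move=> /(ler_wpM2l (sqr_ge0 (alpha k))) /le_trans; apply.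
    by rewrite le_eqVlt; apply/orP; left; apply/eqP; rewrite -/DX; ring.
  have h5 := fx_ge (x t w).
  have LD : 0 <= 2 * L ^+ 2 * DX by rewrite !mulr_ge0 ?sqr_ge0.
  have LC : 0 <= 2 * L ^+ 2 * d%:R * C1 ^+ 2 by rewrite !mulr_ge0 ?sqr_ge0.
  have LH : 0 <= d%:R * L * C1 ^+ 2 / 2 by rewrite !mulr_ge0 ?sqr_ge0 ?invr_ge0.
  have h6 := ler_wpM2l LD q1.
  have h7 := ler_wpM2l LC q2.
  have h8 := ler_wpM2l LH q1.
  have h9 := ler_wpM2l N_ge0 (le_trans h4 (lerD h6 h7)).
  apply: (le_trans h2).
  rewrite -/alpha -/x -/e in h1 *.
  have h10 : \sum_(0 <= k < t) alpha k * dot (g k w) (e k w) <=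
     ln (1 / beta) + N * (2 * L ^+ 2 * DX * Q1 + 2 * L ^+ 2 * d%:R * C1 ^+ 2 * Q2).
    by rewrite h3 lerD.
  have -> : B = f x0 + (ln (1 / beta) + N * (2 * L ^+ 2 * DX * Q1 +
     2 * L ^+ 2 * d%:R * C1 ^+ 2 * Q2)) + d%:R * L * C1 ^+ 2 / 2 * Q1 - fstar.
    by rewrite /B /V /c1 /c2; ring.
  rewrite lerBrDl; apply: (@le_trans _ _ (f (x t w) +
    \sum_(0 <= k < t) alpha k * dot (Phi N1 p (g k w)) (g k w))).
    by rewrite lerD2r.
  by apply: (le_trans h1); rewrite lerD // lerD2l.
(* The target is the bound of [key] divided by the lower bound [AT] on the total step size. *)
have RcE : Rc / T = (2 / dphi0 hd N1 p * B) / (a * T / (1 - delta)).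
  rewrite /Rc /B /Q1 /Q2 -/V -/c1 /c2; field.
  by rewrite !gt_eqF //; lra.
rewrite RcE.
have key2 : \sum_(0 <= k < t) alpha k * m k <= 2 / dphi0 hd N1 p * B.
  rewrite mulrAC ler_pdivlMr // mulrC.
  by have := key; lra.
(* Normalise by the true total [A], then replace it by its smaller lower bound, which is allowed
   since B >= 0. *)
apply: (@le_trans _ _ (2 / dphi0 hd N1 p * B / A)).
  by rewrite ler_wpM2r // invr_ge0 ltW.
rewrite ler_wpM2l ?mulr_ge0 ?invr_ge0 ?(ltW phi0) // lef_pV2 ?posrE //.
by rewrite divr_gt0 ?mulr_gt0 // subr_gt0.
Qed.
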